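(* Let $X$ be the Cantor set, let $F\leq\mathrm{Homeo}(X)$ be finite and let $G=\mathbf{F}(F)$ be the piecewise full group of $F$. The following are equivalent: (i) $F$ is uniformly discrete; (ii) $G$ is uniformly discrete; (iii) $G$ is ample; (iv) for every $f\in F$, the set $\mathrm{Fix}(f)$ of fixed points of $f$ is a clopen subset of $X$; (v) $F$ acts on some clopen partition $\mathcal{P}$ of $X$ such that the setwise stabiliser of each part coincides with its pointwise stabiliser.
   Context: For $G\le \mathrm{Homeo}(X)$, the piecewise full group $\mathbf{F}(G)$ consists of all $g\in\mathrm{Homeo}(X)$ for which there are a finite clopen partition $X=U_1\sqcup\dots\sqcup U_n$ and $g_1,\dots,g_n\in G$ with $g|_{U_i}=g_i|_{U_i}$; $G$ is piecewise full if $\mathbf{F}(G)=G$. $G$ is ample if it is piecewise full, locally finite (every finite subset lies in a finite subgroup), countable, and $\mathrm{Fix}(g)$ is clopen for every $g\in G$. $G$ is uniformly discrete if there is a (finite) clopen partition $\mathcal{P}$ of $X$ with $|Gx\cap U|\le1$ for all $x\in X$ and $U\in\mathcal{P}$. *)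

(* Defs.v *)
From HB Require Import structures.
From mathcomp Require Import all_boot.
From mathcomp Require Import all_classical all_reals all_analysis.

Set Implicit Arguments.
Unset Strict Implicit.
Unset Printing Implicit Defensive.

Local Open Scope classical_set_scope.

(* The inverse is carried as data; it is determined by the map, so Leibniz
   equality is extensional equality of the underlying maps (homeo_ext). *)
Record homeo (X : topologicalType) := Homeo {
  homeo_fun :> X -> X;
  homeo_inv : X -> X;
  homeo_funK : cancel homeo_fun homeo_inv;
  homeo_invK : cancel homeo_inv homeo_fun;
  homeo_fun_continuous : continuous homeo_fun;
  homeo_inv_continuous : continuous homeo_inv
}.

HB.instance Definition _ (X : topologicalType) := gen_eqMixin (homeo X).
HB.instance Definition _ (X : topologicalType) := gen_choiceMixin (homeo X).

Section HomeoGroup.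
Context {X : topologicalType}.
Implicit Types f g h : homeo X.

Lemma homeo_ext f g : f =1 g -> f = g.
Proof.
case: f g => [f f' fK f'K cf cf'] [g g' gK g'K cg cg'] /= /funext fg.
rewrite {}fg in fK f'K cf *.
have f'g' : f' = g' by apply/funext => x; rewrite -{1}(g'K x) fK.
rewrite {}f'g' in fK f'K cf' *.
by congr Homeo; exact: Prop_irrelevance.
Qed.

Definition homeo_one : homeo X :=
  @Homeo X id id (fun=> erefl) (fun=> erefl) (fun=> cvg_id) (fun=> cvg_id).

Definition homeo_invg f : homeo X :=
  Homeo (@homeo_invK X f) (@homeo_funK X f)
        (@homeo_inv_continuous X f) (@homeo_fun_continuous X f).

Lemma homeo_mul_continuous (u v : X -> X) :
  continuous u -> continuous v -> continuous (u \o v).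
Proof. by move=> cu cv x; apply: continuous_comp; [exact: cv|exact: cu]. Qed.

(* (f * g) x = f (g x): homeomorphisms act on the left. *)
Definition homeo_mul f g : homeo X :=
  Homeo (can_comp (@homeo_funK X f) (@homeo_funK X g))
        (can_comp (@homeo_invK X g) (@homeo_invK X f))
        (homeo_mul_continuous (@homeo_fun_continuous X f)
                              (@homeo_fun_continuous X g))
        (homeo_mul_continuous (@homeo_inv_continuous X g)
                              (@homeo_inv_continuous X f)).

Lemma homeo_mulA : associative homeo_mul.
Proof. by move=> f g h; exact: homeo_ext. Qed.

Lemma homeo_mul1 : left_id homeo_one homeo_mul.
Proof. by move=> f; exact: homeo_ext. Qed.

Lemma homeo_mulr1 : right_id homeo_one homeo_mul.
Proof. by move=> f; exact: homeo_ext. Qed.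

Lemma homeo_mulV : left_inverse homeo_one homeo_invg homeo_mul.
Proof. by move=> f; apply: homeo_ext => x; exact: homeo_funK. Qed.

Lemma homeo_mulrV : right_inverse homeo_one homeo_invg homeo_mul.
Proof. by move=> f; apply: homeo_ext => x; exact: homeo_invK. Qed.

End HomeoGroup.

HB.instance Definition _ (X : topologicalType) :=
  isGroup.Build (homeo X) (@homeo_mulA X) (@homeo_mul1 X) (@homeo_mulr1 X)
    (@homeo_mulV X) (@homeo_mulrV X).

Section PiecewiseFull.
Context {X : topologicalType}.
Implicit Types (f g : homeo X) (G H : set (homeo X)) (P : set (set X)).

Definition subgroup G := group_closed (mem G).

(* As in the library's partition, parts are nonempty. *)
Definition clopen_partition P :=
  [/\ finite_set P, partition P id [set: X] & forall U, P U -> clopen U].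

Definition piecewise_full_group G : set (homeo X) :=
  [set g | exists2 P, clopen_partition P &
     forall U, P U -> exists2 h, G h & forall x, U x -> g x = h x].

Definition piecewise_full G := piecewise_full_group G = G.

Definition Fix f : set X := [set x | f x = x].

Definition locally_finite G :=
  forall A : set (homeo X), finite_set A -> A `<=` G ->
  exists H, [/\ subgroup H, H `<=` G, finite_set H & A `<=` H].

(* Local finiteness alone makes G a subgroup, so it is not a separate clause. *)
Definition ample G :=
  [/\ piecewise_full G, locally_finite G, countable G &
      forall g, G g -> clopen (Fix g)].

Definition orbit G (x : X) : set X := [set g x | g in G].

Definition uniformly_discrete G :=
  exists2 P, clopen_partition P &
    forall x U, P U -> is_subset1 (orbit G x `&` U).

Definition acts_on G P :=
  forall g U, G g -> P U -> P (g @` U).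

Definition setwise_stabiliser G (U : set X) : set (homeo X) :=
  [set g | G g /\ g @` U = U].

Definition pointwise_stabiliser G (U : set X) : set (homeo X) :=
  [set g | G g /\ forall x, U x -> g x = x].

End PiecewiseFull.

(* Main.v *)
(* A clopen partition is given as the fibres of a locally constant map to a
   finite type.  By compactness, every g in the piecewise full group G of F agrees
   with elements of F on cylinders of a fixed depth n; for each n there are only
   finitely many such g, so G is countable.  The colouring
   x |-> (prefix of f x)_{f in F} has F-invariant kernel, so the homeomorphisms
   agreeing with an element of F on each of its fibres form a finite group; for
   n large this group contains any prescribed finite part of G.  For n large
   with respect to the displacements f x <> x, the fibres of the same colouring
   are the partition of (v). *)
Require Import Defs.
From mathcomp Require Import all_boot.
From mathcomp Require Import all_classical all_reals all_analysis.
Set Implicit Arguments.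
Unset Strict Implicit.
Unset Printing Implicit Defensive.

Local Open Scope classical_set_scope.

(** * Locally constant colourings and homeomorphisms that are piecewise in a set *)

Section Colourings.
Context {X : topologicalType}.
Implicit Types (S : set (homeo X)) (g : homeo X).

Lemma subgroup1 S : subgroup S -> S homeo_one.
Proof. by case=> /set_mem. Qed.

Lemma subgroupV S g : subgroup S -> S g -> S (homeo_invg g).
Proof.
by move=> Ssub /mem_set Sg; apply/set_mem; exact: (group_closedV Ssub).
Qed.

Lemma subgroupM S g h : subgroup S -> S g -> S h -> S (homeo_mul g h).
Proof.
move=> Ssub /mem_set Sg /mem_set Sh; apply/set_mem.
exact: (group_closedM Ssub).
Qed.

Lemma homeo_near g x (A : set X) :
  nbhs (g x) A -> \forall y \near x, A (g y).
Proof. exact: (@homeo_fun_continuous X g x). Qed.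

Definition locally_constant (T : Type) (c : X -> T) :=
  forall x, \forall y \near x, c y = c x.

(** Indexing by points rather than colours keeps every part nonempty, as [partition] demands. *)
Definition fibres (T : Type) (c : X -> T) : set (set X) :=
  range (fun x => c @^-1` [set c x]).

Lemma locally_constant_clopen (T : Type) (c : X -> T) (A : set T) :
  locally_constant c -> clopen (c @^-1` A).
Proof.
have op (B : set T) : locally_constant c -> open (c @^-1` B).
  move=> lc; rewrite openE => x /= Bx; apply: filterS (lc x) => y /= cyx.
  by rewrite /= cyx.
by move=> lc; split; [exact: op | rewrite -openC; exact: (op (~` A))].
Qed.

Lemma fibres_clopen_partition (T : finType) (c : X -> T) :
  locally_constant c -> clopen_partition (fibres c).
Proof.
move=> lc; split.
- apply: (@sub_finite_set _ _ ((fun t => c @^-1` [set t]) @` [set: T])).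
    by move=> _ [x _ <-]; exists (c x).
  exact/finite_image/finite_finset.
- split.
  + by apply/seteqP; split=> // x _; exists (c @^-1` [set c x]) => //; exists x.
  + move=> _ _ [x _ <-] [y _ <-] [z [/= zx zy]].
    by rewrite -zx -zy.
  + by move=> _ [x _ <-]; exists x.
- by move=> _ [x _ <-]; exact: locally_constant_clopen.
Qed.

Definition piecewise (T : Type) (c : X -> T) S : set (homeo X) :=
  [set g | forall x, exists2 h, S h & forall y, c y = c x -> g y = h y].

(** Such a homeomorphism is determined by a choice of one element of [S] per colour, and there are
    finitely many choices. *)
Lemma piecewise_finite (T : finType) (c : X -> T) S :
  finite_set S -> finite_set (piecewise c S).
Proof.
have [-> _|/set0P[h0 Sh0]] := eqVneq S set0.
  apply: (@sub_finite_set _ _ [set homeo_one]) => // g gP.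
  by apply: homeo_ext => x; have [] := gP x.
move=> /finite_seqP[s sE].
have inS h : S h -> h \in s by rewrite sE.
(* The default [homeo_one] is taken when the pieces chosen by [p] do not glue to a homeomorphism. *)
pose glue (p : {ffun T -> seq_sub s}) :=
  xget homeo_one [set g : homeo X | forall x, g x = ssval (p (c x)) x].
apply: (@sub_finite_set _ _ (glue @` setT)); last first.
  exact/finite_image/finite_finset.
move=> g gP.
have /choice[p pP] : forall t, exists h : seq_sub s,
    forall y, c y = t -> g y = ssval h y.
  move=> t; have [[x <-]|nt] := pselect (exists x, c x = t).
    have [h Sh gh] := gP x.
    by exists (SeqSub (inS _ Sh)).
  (* A colour that is not attained gets the arbitrary element [h0]. *)
  by exists (SeqSub (inS _ Sh0)) => y cy; case: nt; exists y.
exists (finfun p) => //; rewrite /glue; apply: xget_unique.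
  by move=> x /=; rewrite ffunE; exact: pP.
by move=> k kP; apply: homeo_ext => x; rewrite kP ffunE; apply/esym/pP.
Qed.

Lemma piecewise_sub (T : finType) (c : X -> T) S :
  locally_constant c -> piecewise c S `<=` piecewise_full_group S.
Proof.
move=> lc g gP; exists (fibres c); first exact: fibres_clopen_partition.
by move=> _ [x _ <-]; have [h Sh gh] := gP x; exists h.
Qed.

Lemma piecewise_full_group_near S g :
  piecewise_full_group S g ->
  forall x : X, exists2 h, S h & \forall y \near x, g y = h y.
Proof.
move=> [P [_ [Pcov _ _] Pcl] gP] x.
have [U PU Ux] : cover P id x by rewrite Pcov.
have [h Sh gh] := gP U PU; exists h => //.
apply: (filterS gh).
by apply: open_nbhs_nbhs; split=> //; have [] := Pcl U PU.
Qed.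

Lemma sub_piecewise_full_group S : S `<=` piecewise_full_group S.
Proof.
move=> g Sg.
apply: (@piecewise_sub unit (fun=> tt)); first by move=> x; exact: nearW.
by move=> x; exists g.
Qed.

(** Elements of [S] permute the fibres. Hence the inverse of [k] carries a fibre into a single
    fibre, as one element of [S] does, and there [g] again agrees with one element of [S]. *)
Lemma piecewise_subgroup (T : Type) (c : X -> T) S :
  subgroup S ->
  (forall g x y, S g -> c x = c y -> c (g x) = c (g y)) ->
  subgroup (piecewise c S).
Proof.
move=> Ssub cinv; split.
  by apply: mem_set => x; exists homeo_one => //; exact: subgroup1.
move=> g k /set_mem gP /set_mem kP; apply: mem_set => x.
pose z := homeo_inv k x.
have [g0 Sg0 gg0] := gP z; have [k0 Sk0 kk0] := kP z.
have k0z : homeo_inv k0 x = z.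
  by rewrite -[LHS]/(homeo_inv k0 x) -(homeo_invK k x) kk0 // homeo_funK.
exists (homeo_mul g0 (homeo_invg k0)).
  by apply: subgroupM => //; exact: subgroupV.
move=> y cyx.
have cz : c (homeo_inv k0 y) = c z.
  by rewrite -k0z; apply: (cinv (homeo_invg k0)) => //; exact: subgroupV.
have ky : homeo_inv k y = homeo_inv k0 y.
  by rewrite -{1}(homeo_invK k0 y) -kk0 // homeo_funK.
by rewrite /= ky; exact: gg0.
Qed.

End Colourings.

(** * Refining a colouring to one with invariant kernel *)

Section InvariantColouring.
Context {X : topologicalType} (s : seq (homeo X)).

Definition orbit_colouring (T : Type) (c : X -> T) (x : X) :
  {ffun seq_sub s -> T} := [ffun f : seq_sub s => c (ssval f x)].

Lemma orbit_colouring_locally_constant (T : Type) (c : X -> T) :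
  locally_constant c -> locally_constant (orbit_colouring c).
Proof.
move=> lc x.
have : \forall y \near x, forall f : seq_sub s, c (ssval f y) = c (ssval f x).
  by apply: filter_forall => f; exact: (homeo_near (lc _)).
by apply: filterS => y yP; apply/ffunP => f; rewrite !ffunE.
Qed.

Lemma orbit_colouringE (T : Type) (c : X -> T) f x y :
  f \in s -> orbit_colouring c x = orbit_colouring c y -> c (f x) = c (f y).
Proof. by move=> fs /ffunP /(_ (SeqSub fs)); rewrite !ffunE. Qed.

(** The entry at [f] of the colour of [g x] is the entry at the product of [f] and [g] of the colour
    of [x]. *)
Lemma orbit_colouring_invariant (T : Type) (c : X -> T) g x y :
  subgroup [set` s] -> g \in s ->
  orbit_colouring c x = orbit_colouring c y ->
  orbit_colouring c (g x) = orbit_colouring c (g y).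
Proof.
move=> ssub gs cxy; apply/ffunP => -[f fs]; rewrite !ffunE /=.
exact: (orbit_colouringE (subgroupM ssub fs gs) cxy).
Qed.

End InvariantColouring.

(** * Cylinders of the Cantor space and compactness *)

Section Prefix.
Implicit Types (x y : cantor_space) (S : set (homeo cantor_space)).

Definition prefix n x : {ffun 'I_n -> bool} := [ffun i => x (nat_of_ord i)].

Lemma coordinate_locally_constant i :
  locally_constant (fun x : cantor_space => x i).
Proof.
move=> x; have := @proj_continuous nat (fun=> bool) i x.
by move/discrete_cvg.
Qed.

Lemma prefix_locally_constant n : locally_constant (prefix n).
Proof.
move=> x; have : \forall y \near x, forall i : 'I_n,
    (y : cantor_space) (nat_of_ord i) = x (nat_of_ord i).
  apply: (@filter_forall cantor_space _
    (fun i y => y (nat_of_ord i) = x (nat_of_ord i)) (nbhs x)) => i.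
  exact: coordinate_locally_constant.
by apply: filterS => y yP; apply/ffunP => i; rewrite !ffunE.
Qed.

Lemma prefix_le m n x y : (m <= n)%N -> prefix n x = prefix n y ->
  prefix m x = prefix m y.
Proof.
move=> mn /ffunP xy; apply/ffunP => i.
by have := xy (widen_ord mn i); rewrite !ffunE.
Qed.

Lemma prefix_sep x y : (forall n, prefix n x = prefix n y) -> x = y.
Proof.
move=> xy; apply/funext => n.
by have /ffunP/(_ ord_max) := xy n.+1; rewrite !ffunE.
Qed.

(** This is compactness in its near-covering form, with depths tending to infinity as the parameter;
    it is the source of all uniform depths below. *)
Lemma uniform_depth (P : nat -> set cantor_space) :
  (forall x, exists m, \forall y \near x, forall n, (m <= n)%N -> P n y) ->
  \forall n \near \oo, forall x, P n x.
Proof.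
move=> Ploc.
have /compact_near_coveringP cov := cantor_space_compact.
apply: (@filterS _ \oo _ (fun n => [set: cantor_space] `<=` P n)).
  by move=> n Pn x; exact: Pn.
apply: (cov _ \oo) => x _; have [m mP] := Ploc x.
exists ([set y | forall n, (m <= n)%N -> P n y], [set n | (m <= n)%N]).
  by split=> //; exists m.
by move=> [y n] [/= yP mn]; exact: yP.
Qed.

Lemma prefix_basis x (A : set cantor_space) :
  nbhs x A -> exists n, forall y, prefix n y = prefix n x -> A y.
Proof.
move=> xA.
(* Near [x] the conclusion [A] holds at every depth; near any other point the premise fails from the
   first separating depth on. *)
have [|N _ /(_ N)/(_ (leqnn N)) ?] :=
    @uniform_depth (fun n y => prefix n y = prefix n x -> A y); last by exists N.
move=> y; have [->|yx] := pselect (y = x).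
  by exists 0%N; apply: filterS xA => z Az n.
have [m mP] : exists m, prefix m y <> prefix m x.
  by apply/existsNP => /prefix_sep.
exists m; apply: filterS (prefix_locally_constant m y) => z zy n mn zx.
by case: mP; rewrite -zy; exact: prefix_le zx.
Qed.

Lemma piecewise_prefix S (g : homeo cantor_space) :
  (forall x, exists2 h, S h & \forall y \near x, g y = h y) ->
  \forall n \near \oo, piecewise (prefix n) S g.
Proof.
move=> gS; apply: uniform_depth => x.
have [h Sh /prefix_basis[m mP]] := gS x.
exists m; apply: filterS (prefix_locally_constant m x) => y yx n mn.
by exists h => // z zy; apply: mP; rewrite -yx; exact: prefix_le zy.
Qed.

(** Compactness turns agreement near each point into a finite clopen partition. Idempotence of the
    construction then reduces to transitivity of local agreement. *)
Lemma piecewise_full_groupP S (g : homeo cantor_space) :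
  piecewise_full_group S g <->
  forall x, exists2 h, S h & \forall y \near x, g y = h y.
Proof.
split; first exact: piecewise_full_group_near.
move=> /piecewise_prefix[n _ /(_ n (leqnn n))].
by apply: piecewise_sub; exact: prefix_locally_constant.
Qed.

Lemma piecewise_full_group_full S : piecewise_full (piecewise_full_group S).
Proof.
apply/seteqP; split; last exact: sub_piecewise_full_group.
move=> g /piecewise_full_groupP gG; apply/piecewise_full_groupP => x.
have [h /piecewise_full_groupP/(_ x)[k Sk hk] gh] := gG x.
by exists k => //; near=> y; rewrite (near gh y) ?(near hk y).
Unshelve. all: by end_near. Qed.

Lemma piecewise_full_group_countable S :
  finite_set S -> countable (piecewise_full_group S).
Proof.
move=> fS; apply: (@sub_countable _ _ _
  (\bigcup_n piecewise (prefix n) S)).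
  apply: subset_card_le => g /piecewise_full_groupP/piecewise_prefix[n _ gn].
  by exists n; [|exact: (gn n (leqnn n))].
apply: bigcup_countable => // n _.
exact/finite_set_countable/piecewise_finite.
Qed.

Lemma piecewise_full_group_locally_finite S :
  subgroup S -> finite_set S -> locally_finite (piecewise_full_group S).
Proof.
move=> Ssub fS A /finite_seqP[t ->] AG; have /finite_seqP[s sE] := fS.
have : \forall n \near \oo, forall g : seq_sub t,
    piecewise (prefix n) S (ssval g).
  apply: filter_forall => -[g gt].
  by apply: piecewise_prefix; exact/piecewise_full_groupP/AG.
move=> [n _ /(_ n (leqnn n)) nP].
have lc := @orbit_colouring_locally_constant _ s _ _ (prefix_locally_constant n).
exists (piecewise (orbit_colouring s (prefix n)) S); split.
- apply: piecewise_subgroup => // g x y; rewrite sE in Ssub *.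
  exact: orbit_colouring_invariant.
- exact: piecewise_sub.
- exact: piecewise_finite.
- move=> g gt x; have [h Sh gh] := nP (SeqSub gt) x; exists h => // y cyx.
  (* The entry at [homeo_one] is the prefix itself, so the orbit colouring refines [prefix n]. *)
  apply: gh; apply: (@orbit_colouringE _ s _ _ homeo_one) cyx.
  by have := subgroup1 Ssub; rewrite sE.
Qed.

(** A displacement visible at depth [m] stays visible nearby and at greater depths, while openness
    surrounds each fixed point by fixed points; compactness then gives one depth. *)
Lemma prefix_displaced (f : homeo cantor_space) : open (Fix f) ->
  \forall n \near \oo, forall x, prefix n (f x) = prefix n x -> f x = x.
Proof.
move=> oF; apply: uniform_depth => x.
have [fx|fx] := pselect (f x = x).
  exists 0%N; have : nbhs x (Fix f) by exact: open_nbhs_nbhs.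
  by apply: filterS => y fy n.
have [m mP] : exists m, prefix m (f x) <> prefix m x.
  by apply/existsNP => /prefix_sep.
exists m; near=> y => n mn fy; case: mP.
have <- : prefix m (f y) = prefix m (f x).
  near: y; exact: (homeo_near (prefix_locally_constant m _)).
have <- : prefix m y = prefix m x.
  near: y; exact: prefix_locally_constant.
exact: prefix_le fy.
Unshelve. all: by end_near. Qed.

End Prefix.

(** * Uniform discreteness, fixed points and the cycle of implications *)

Lemma uniformly_discrete_piecewise_full_group (X : topologicalType)
    (S : set (homeo X)) :
  uniformly_discrete S -> uniformly_discrete (piecewise_full_group S).
Proof.
(* At each point an element of the piecewise full group takes the value of some element of [S], so
   the same partition serves. *)
have sub x : Defs.orbit (piecewise_full_group S) x `<=` Defs.orbit S x.
  move=> _ [g /piecewise_full_group_near/(_ x)[h Sh /nbhs_singleton gh] <-].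
  by exists h.
move=> [P cP Pdisc]; exists P => // x U PU y z [/sub Sy Uy] [/sub Sz Uz].
by apply: (Pdisc x U PU); split.
Qed.

Lemma uniformly_discrete_Fix_clopen (X : topologicalType)
    (S : set (homeo X)) g :
  uniformly_discrete S -> S homeo_one -> S g -> clopen (Fix g).
Proof.
move=> [P [_ [Pcov Ptriv _] Pcl] Pdisc] S1 Sg.
have cov x : exists2 U, P U & U x.
  have : cover P id x by rewrite Pcov.
  by move=> [U PU Ux]; exists U.
have Pnbhs U x : P U -> U x -> nbhs x U.
  by move=> PU Ux; apply: open_nbhs_nbhs; split=> //; have [] := Pcl U PU.
have fixed x U : P U -> U x -> U (g x) -> g x = x.
  move=> PU Ux Ugx; apply: (Pdisc x U PU); split=> //; first by exists g.
  by exists homeo_one.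
split.
  rewrite openE => x gx; have [U PU Ux] := cov x.
  near=> y; apply: (fixed y U) => //; near: y; first exact: Pnbhs.
  by apply: homeo_near; rewrite gx; exact: Pnbhs.
rewrite -openC openE => x gx.
have [U PU Ux] := cov x; have [V PV Vgx] := cov (g x).
near=> y; move=> gy; apply: gx; apply: (fixed x U) => //.
(* A fixed point [y] close to [x] would lie in both parts, forcing [x] and [g x] into one part. *)
suff -> : U = V by [].
apply: Ptriv => //; exists y; split; [|rewrite /= -gy]; near: y.
  exact: Pnbhs.
exact: (homeo_near (Pnbhs _ _ PV Vgx)).
Unshelve. all: by end_near. Qed.

Theorem proposition4p1 (F : set (homeo cantor_space))
    (F_subgroup : subgroup F) (F_finite : finite_set F) :
  let G := piecewise_full_group F in
  [<-> uniformly_discrete F;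
       uniformly_discrete G;
       ample G;
       forall f, F f -> clopen (Fix f);
       exists P : set (set cantor_space),
         [/\ clopen_partition P, acts_on F P &
             forall U, P U ->
               setwise_stabiliser F U = pointwise_stabiliser F U]].
Proof.
move=> G; have FG : F `<=` G by exact: sub_piecewise_full_group.
tfae.
- exact: uniformly_discrete_piecewise_full_group.
- move=> Gdisc; split.
  + exact: piecewise_full_group_full.
  + exact: piecewise_full_group_locally_finite.
  + exact: piecewise_full_group_countable.
  + move=> g; apply: uniformly_discrete_Fix_clopen => //.
    by apply: FG; exact: subgroup1.
- by move=> [_ _ _ Gfix] f /FG; exact: Gfix.
- move=> Ffix; have /finite_seqP[s sE] := F_finite.
  have : \forall n \near \oo, forall f : seq_sub s,
      forall x, prefix n (ssval f x) = prefix n x -> ssval f x = x.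
    apply: filter_forall => -[f fs]; apply: prefix_displaced.
    by have [] : clopen (Fix f) by apply: Ffix; rewrite sE.
  move=> [n _ /(_ n (leqnn n)) nP].
  pose c := orbit_colouring s (prefix n).
  have cinv g x y : F g -> c x = c y -> c (g x) = c (g y).
    move: F_subgroup; rewrite sE; exact: orbit_colouring_invariant.
  exists (fibres c); split.
  + apply: fibres_clopen_partition; apply: orbit_colouring_locally_constant.
    exact: prefix_locally_constant.
  + move=> g _ Fg [x _ <-]; exists (g x) => //; apply/seteqP; split=> y /=.
      move=> cy; exists (homeo_inv g y); last exact: homeo_invK.
      rewrite /= -(homeo_funK g x).
      exact: (cinv (homeo_invg g) _ _ (subgroupV F_subgroup Fg)).
    by move=> [z /= cz <-]; exact: cinv.
  + move=> _ [x _ <-]; apply/seteqP; split=> g [Fg gU]; split=> //.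
      (* If [g] preserves the fibre, then [y] and [g y] share a colour, hence a prefix of length
         [n], which is too long for [g] to displace [y]. *)
      move=> y Uy; have gs : g \in s by move: Fg; rewrite sE.
      apply: (nP (SeqSub gs)) => /=.
      apply: (@orbit_colouringE _ s _ _ homeo_one).
        by have := subgroup1 F_subgroup; rewrite sE.
      have : (c @^-1` [set c x]) (g y) by rewrite -gU; exists y.
      by move=> /= cgy; exact: etrans cgy (esym Uy).
    apply/seteqP; split=> [_ [y Uy <-]|y Uy]; first by rewrite gU.
    by exists y => //; rewrite gU.
- move=> [P [cP Pact Pstab]]; exists P => // x U PU y z.
  move=> [[f Ff <-] Ufx] [[h Fh <-] Uhx].
  (* [k] moves one orbit point in [U] to the other, so its image of [U] is a part meeting [U], hence
     [U] itself; the stabiliser condition makes [k] fix both points. *)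
  pose k := homeo_mul h (homeo_invg f).
  have Fk : F k by apply: subgroupM => //; exact: subgroupV.
  have kf : k (f x) = h x by rewrite /= homeo_funK.
  have kU : k @` U = U.
    have [_ [_ Ptriv _] _] := cP.
    apply: Ptriv => //; first exact: Pact.
    by exists (h x); split=> //; exists (f x).
  have [_ kfix] : pointwise_stabiliser F U k by rewrite -Pstab.
  by rewrite -kf kfix.
Qed.
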